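(* Suppose that $\kappa \geq \lambda \geq \mu$ are infinite cardinals, and that either $\kappa > \lambda$ or $\kappa$ is regular. Then every weakly $[\mu, \kappa]$-compact topological space is pseudo-$(\kappa, \operatorname{COV}(\kappa, \lambda, \mu))$-compact.
   Context: A topological space $X$ is weakly $[\mu,\kappa]$-compact if every open cover of $X$ of cardinality $\leq \kappa$ has a subset of cardinality $< \mu$ whose union is dense in $X$. For infinite cardinals $\kappa \geq \lambda \geq \mu$, $\operatorname{COV}(\kappa,\lambda,\mu)$ denotes the minimal cardinality of a family of subsets of $\kappa$, each of cardinality $< \lambda$, such that every subset of $\kappa$ of cardinality $< \mu$ is contained in at least one set of the family. For cardinals $\kappa, \nu$, a topological space $X$ is pseudo-$(\kappa,\nu)$-compact if for every $\nu$-indexed sequence $(O_\alpha)_{\alpha \in \nu}$ of nonempty open subsets of $X$ (repetitions allowed) there is $x \in X$ such that, for every neighborhood $U$ of $x$, $|\{\alpha \in \nu \mid U \cap O_\alpha \neq \emptyset\}| \geq \kappa$. *)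

(* Defs.v *)
From mathcomp Require Import all_boot.
From mathcomp Require Import boolp wochoice classical_sets functions cardinality.
From mathcomp Require Import topology.

Set Implicit Arguments.
Unset Strict Implicit.
Unset Printing Implicit Defensive.

Local Open Scope classical_set_scope.
Local Open Scope card_scope.

(* A cardinal is given by a type (or a set) having it as cardinality; cardinals
   are only compared through the relations #<=, #= and #<. *)

Definition card_lt T U (A : set T) (B : set U) : bool := (A #<= B) && (A #!= B).

Notation "A '#<' B" := (card_lt A B)
  (at level 79, format "A  '#<'  B") : card_scope.

(* R (reflexive, as in wochoice) well-orders kappa in the order type of the
   cardinal |kappa|, i.e., of the least ordinal of that cardinality. *)
Definition initial_well_order (kappa : Type) (R : rel kappa) : Prop :=
  well_order R /\
  forall a : kappa, [set b | R b a /\ b <> a] #< [set: kappa].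

Definition cofinal (kappa : Type) (R : rel kappa) (C : set kappa) : Prop :=
  forall a, exists2 c, C c & R a c.

(* The cofinality of kappa is kappa.  As initial well-orders of kappa are
   isomorphic, it does not matter which one is taken. *)
Definition regular_cardinal (kappa : Type) : Prop :=
  infinite_set [set: kappa] /\
  exists2 R : rel kappa, initial_well_order R &
    forall C : set kappa, cofinal R C -> C #= [set: kappa].

Definition COV_family (kappa lambda mu : Type) (F : set (set kappa)) : Prop :=
  (forall Z, F Z -> Z #< [set: lambda]) /\
  (forall W : set kappa, W #< [set: mu] -> exists2 Z, F Z & W `<=` Z).

Definition min_COV_family (kappa lambda mu : Type) (F : set (set kappa)) : Prop :=
  COV_family lambda mu F /\
  forall G : set (set kappa), COV_family lambda mu G -> F #<= G.

(* COV(kappa, lambda, mu) is represented by a covering family having this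
   cardinal as cardinality; see COV_min for the existence of such a family. *)
Definition COV (kappa lambda mu : Type) : set (set kappa) :=
  xget set0 (@min_COV_family kappa lambda mu).
Arguments COV : clear implicits.

Definition weakly_compact (mu kappa : Type) (X : topologicalType) : Prop :=
  forall F : set (set X),
    (forall A, F A -> open A) ->
    \bigcup_(A in F) A = [set: X] ->
    F #<= [set: kappa] ->
    exists G : set (set X),
      [/\ G `<=` F, G #< [set: mu] & dense (\bigcup_(A in G) A)].

Definition pseudo_compact (kappa nu : Type) (X : topologicalType) : Prop :=
  forall O : nu -> set X,
    (forall a, open (O a)) ->
    (forall a, O a !=set0) ->
    exists x : X, forall U, nbhs x U ->
      [set: kappa] #<= [set a | U `&` O a !=set0].

Lemma card_le_rel T U (A : set T) (B : set U) (E : T -> U -> Prop) :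
  (forall x, A x -> exists2 y, B y & E x y) ->
  (forall x x' y, A x -> A x' -> E x y -> E x' y -> x = x') ->
  A #<= B.
Proof.
move=> totE injE.
have ex (x : A) : exists y : B, E (val x) (val y).
  have [y By Exy] := totE _ (set_mem (valP x)).
  by exists (SigSub (mem_set By)).
have [f fP] := choice ex.
suff /Pinj[g _] : {in [set: A] &, injective f}.
  by apply/card_leP; squash (totalfun_ [set: A] g).
move=> x y _ _ eqf; apply/val_inj.
apply: (injE _ _ (val (f x))); try exact/set_mem/valP; first exact: fP.
by rewrite eqf; exact: fP.
Qed.

Lemma ex_min_card T (P : set (set T)) :
  P !=set0 -> exists2 A, P A & forall B, P B -> A #<= B.
Proof.
move=> [A0 PA0].
pose Q (S : set (set T -> T)) :=
  (forall f A, S f -> P A -> A (f A)) /\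
  (forall f g A, S f -> S g -> P A -> f A = g A -> f = g).
have [|S [[Smem Sinj] Smax]] := @Zorn_bigcup _ Q.
  move=> F FQ totF; split=> [f A [S FS Sf] PA|f g A [S FS Sf] [S' FS' S'g] PA].
    by have [SFmem _] := FQ _ FS; exact: (SFmem f A Sf PA).
  have [sub|sub] := totF _ _ FS FS'.
    by have [_ +] := FQ _ FS'; apply=> //; exact: sub.
  by have [_ +] := FQ _ FS; apply=> //; exact: sub.
have [[A PA Asurj]|nosurj] :=
    pselect (exists2 A, P A & forall x, A x -> exists2 f, S f & f A = x).
  exists A => // B PB.
  apply: (@card_le_rel _ _ A B (fun x y => exists2 f, S f & f A = x /\ f B = y)).
    move=> x /Asurj[f Sf fx]; exists (f B); first exact: (Smem f B).
    by exists f.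
  move=> x x' y _ _ [f Sf [<- fy]] [g Sg [<- gy]].
  by rewrite (Sinj f g B) // fy gy.
exfalso.
have ex A : exists x, P A -> A x /\ forall f, S f -> f A <> x.
  have [PA|nPA] := pselect (P A); last first.
    have [[x _]|A00] := pselect (A0 !=set0); first by exists x.
    by exfalso; apply: nosurj; exists A0 => // x A0x; case: A00; exists x.
  apply: contrapT => nex; apply: nosurj; exists A => // x Ax.
  apply: contrapT => nf; apply: nex; exists x => _; split=> // f Sf fx.
  by apply: nf; exists f.
have [g gP] := choice ex.
have Sg : ~ S g by move=> Sg; have [_ /(_ g Sg)] := gP _ PA0.
apply: (Smax (S `|` [set g])).
  split=> [|sub]; first by move=> f Sf; left.
  by apply: Sg; apply: sub; right.
split=> [f A [Sf|->] PA|f h A [Sf|->] [Sh|->] PA] //.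
- exact: (Smem f A Sf PA).
- by have [] := gP _ PA.
- exact: Sinj.
- by have [_ /(_ f Sf)] := gP _ PA.
- by move=> eqh; have [_ /(_ h Sh)] := gP _ PA; rewrite eqh.
Qed.

Lemma card_lt_le_trans T U V (A : set T) (B : set U) (C : set V) :
  A #< B -> B #<= C -> A #< C.
Proof.
move=> /andP[leAB neAB] leBC; apply/andP; split.
  exact: card_le_trans leAB leBC.
apply: contra neAB => eqAC; rewrite card_eq_le leAB /=.
by apply: card_le_trans leBC _; move: eqAC; rewrite card_eq_le => /andP[].
Qed.

Lemma COV_min (kappa lambda mu : Type) :
  [set: mu] #<= [set: lambda] ->
  min_COV_family lambda mu (COV kappa lambda mu).
Proof.
move=> le_mu_lambda; apply: xgetPex.
have [|F covF minF] := @ex_min_card _ (@COV_family kappa lambda mu).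
  exists [set Z | Z #< [set: lambda]]; split=> // W ltW; exists W => //.
  exact: card_lt_le_trans ltW le_mu_lambda.
by exists F.
Qed.

(* Main.v *)
Require Import Defs.
From mathcomp Require Import all_boot.
From mathcomp Require Import boolp classical_sets functions cardinality topology.

(** Suppose that every point [x] has a neighborhood [U x] meeting fewer than
    [kappa] of the open sets [O Z], where [Z] runs through a covering family.
    For [alpha] in [kappa] let [V alpha] be the interior of the complement of
    the union of the [O Z] with [alpha] in [Z].  The fewer than [kappa] many [Z]
    such that [U x] meets [O Z] have cardinality less than [lambda], so they do
    not cover [kappa], and [x] is in [V alpha] for any [alpha] that they miss.
    Hence the [V alpha] form an open cover of cardinality at most [kappa].  But
    fewer than [mu] many indices [alpha] all lie in one [Z] of the family, so
    the corresponding [V alpha] are disjoint from [O Z] and their union is not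
    dense. *)

Local Open Scope classical_set_scope.
Local Open Scope card_scope.

(** * Comparison of cardinals, sums and products *)

(** Converse of [card_le_rel]: working with relations on the ambient types avoids injections between
    subtypes. *)
Lemma card_leW_rel {T U} {A : set T} {B : set U} :
  A #<= B -> exists2 E : T -> U -> Prop,
    (forall x, A x -> exists2 y, B y & E x y) &
    (forall x x' y, E x y -> E x' y -> x = x').
Proof.
move=> /card_leP[f].
exists (fun x y => exists2 a : A, val a = x & val (f a) = y).
  move=> x Ax; exists (val (f (SigSub (mem_set Ax)))); first exact/set_mem/valP.
  by exists (SigSub (mem_set Ax)).
move=> x x' y [a <- <-] [b <- /val_inj eqf]; congr val.
by apply: (@inj _ _ _ f); rewrite ?in_setT.
Qed.

(** Copies of [A] and [B] inside [T + U] form a family of sets over one type, and [ex_min_card]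
    picks a least one of the two. *)
Lemma card_le_total {T U} (A : set T) (B : set U) : A #<= B \/ B #<= A.
Proof.
have leA (f : T -> T + U) : injective f -> A #<= f @` A.
  move=> fI; apply: (@card_le_rel _ _ _ _ (fun x y => y = f x)) => [x Ax|].
    by exists (f x) => //; exists x.
  by move=> x x' y _ _ -> /fI.
have leB (f : U -> T + U) : injective f -> B #<= f @` B.
  move=> fI; apply: (@card_le_rel _ _ _ _ (fun x y => y = f x)) => [x Bx|].
    by exists (f x) => //; exists x.
  by move=> x x' y _ _ -> /fI.
have [|S PS minS] := @ex_min_card _ [set inl @` A; inr @` B].
  by exists (inl @` A); left.
case: PS minS => -> minS; [left|right].
- apply: card_le_trans (card_image_le (@inr T U) _).
  by apply: card_le_trans (minS _ (or_intror erefl)); apply: leA => x y [].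
- apply: card_le_trans (card_image_le (@inl T U) _).
  by apply: card_le_trans (minS _ (or_introl erefl)); apply: leB => x y [].
Qed.

Lemma card_le_setX {T T' U U'}
    {A : set T} {A' : set T'} {B : set U} {B' : set U'} :
  A #<= A' -> B #<= B' -> A `*` B #<= A' `*` B'.
Proof.
move=> /card_leW_rel[E totE injE] /card_leW_rel[F totF injF].
apply: (@card_le_rel _ _ _ _ (fun p q => E p.1 q.1 /\ F p.2 q.2)).
  move=> [x y] [/= /totE[x' A'x' Exx'] /totF[y' B'y' Fyy']].
  by exists (x', y').
move=> [x1 y1] [x2 y2] [x y] _ _ /= [E1 F1] [E2 F2].
by rewrite (injE _ _ _ E1 E2) (injF _ _ _ F1 F2).
Qed.

(** Two distinct elements [d] and [e] of [M] tag the elements coming from [A] and from [B]. *)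
Lemma card_le_setU_setX {T U} {A B : set T} {M : set U} :
  infinite_set M -> A #<= M -> B #<= M -> A `|` B #<= M `*` M.
Proof.
move=> infM /card_leW_rel[E totE injE] /card_leW_rel[F totF injF].
have [d Md] := infinite_setN0 infM.
have [e [Me ned]] := infinite_setN0 (infinite_setD infM (finite_set1 d)).
apply: (@card_le_rel _ _ _ _ (fun x p =>
  (p.1 = d /\ E x p.2) \/ (p.1 = e /\ F x p.2))).
  move=> x [/totE[y My Exy]|/totF[y My Fxy]].
    by exists (d, y) => //; left.
  by exists (e, y) => //; right.
move=> x x' [m y] _ _ /= [[-> Ex]|[-> Fx]] [[em Ex']|[em Fx']].
- exact: injE Ex Ex'.
- by case: ned.
- by case: ned.
- exact: injF Fx Fx'.
Qed.

(** * The square of an infinite cardinal, by Zorn's lemma *)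

Section Squares.
Context {T : Type}.
Implicit Types (A D : set T) (S : set (T * T * T)).

(* S is the graph of an injection D * D -> D, where the set D is read off from
   the diagonal so that the union of a chain is again such a graph. *)
Definition sq_dom S : set T := [set x | exists z, S (x, x, z)].

Definition sq_inj A S : Prop :=
  [/\ sq_dom S `<=` A,
      forall x y, sq_dom S x -> sq_dom S y ->
        exists2 z, sq_dom S z & S (x, y, z),
      forall x y z, S (x, y, z) -> [/\ sq_dom S x, sq_dom S y & sq_dom S z] &
      forall p q z, S (p, z) -> S (q, z) -> p = q].

Lemma sub_sq_dom {S S'} : S `<=` S' -> sq_dom S `<=` sq_dom S'.
Proof. by move=> sub x [z Sz]; exists z; exact: sub. Qed.

Lemma sq_inj_bigcup {A} {F : set (set (T * T * T))} :
  (forall S, F S -> sq_inj A S) -> total_on F subset ->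
  sq_inj A (\bigcup_(S in F) S).
Proof.
move=> FQ totF; have supF S : F S -> S `<=` \bigcup_(S in F) S.
  by move=> FS p Sp; exists S.
split.
- move=> x [z [S FS Sx]]; have [domA _ _ _] := FQ _ FS.
  by apply: domA; exists z.
- move=> x y [u [S FS Sx]] [v [S' FS' S'y]].
  wlog sub : x y u v S S' FS FS' Sx S'y / S `<=` S'.
    move=> wl; have [sub|sub] := totF _ _ FS FS'.
      exact: (wl x y u v S S' FS FS' Sx S'y sub).
    have [_ ex _ _] := FQ _ FS.
    have [||z dz Sz] := ex x y; [by exists u | by exists v; exact: sub |].
    by exists z; [exact: sub_sq_dom (supF _ FS) _ dz | exists S].
  have [_ ex _ _] := FQ _ FS'.
  have [||z dz Sz] := ex x y; [by exists u; exact: sub | by exists v |].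
  by exists z; [exact: sub_sq_dom (supF _ FS') _ dz | exists S'].
- move=> x y z [S FS Sz]; have [_ _ dom _] := FQ _ FS.
  have [dx dy dz] := dom _ _ _ Sz.
  by split; apply: (sub_sq_dom (supF _ FS)).
- move=> p q z [S FS Sp] [S' FS' Sq].
  have [sub|sub] := totF _ _ FS FS'.
    by have [_ _ _ I] := FQ _ FS'; apply: I Sq; exact: sub.
  by have [_ _ _ I] := FQ _ FS; apply: I (sub _ Sq).
Qed.

Lemma sq_inj_card {A S} : sq_inj A S -> sq_dom S `*` sq_dom S #<= sq_dom S.
Proof.
move=> [_ ex _ injS]; apply: (@card_le_rel _ _ _ _ (fun p z => S (p, z))).
  by move=> [x y] [dx dy]; exact: ex.
by move=> p q z _ _; exact: injS.
Qed.

(** Starting point for Zorn's lemma: a copy of [nat] in [A], with [pickle] as pairing function. *)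
Lemma sq_inj_nat {A} : infinite_set A ->
  exists2 S, sq_inj A S & infinite_set (sq_dom S).
Proof.
move=> /infiniteP/card_leW_rel[E totE injE].
have ex n : exists y, A y /\ E n y by have [y] := totE n I; exists y.
have [f fP] := choice ex.
have fI : injective f.
  move=> m n eqf; apply: (injE _ _ (f m)); first by case: (fP m).
  by rewrite eqf; case: (fP n).
pose S := range (fun p : nat * nat => (f p.1, f p.2, f (pickle p))).
have domS : sq_dom S = range f.
  apply/seteqP; split=> [x [z [p _ [<- _ _]]]|_ [n _ <-]]; first by exists p.1.
  by exists (f (pickle (n, n))); exists (n, n).
exists S; last first.
  rewrite domS; apply/infiniteP.
  apply: (@card_le_rel _ _ _ _ (fun x y => y = f x)) => [x _|].
    by exists (f x) => //; exists x.
  by move=> x x' y _ _ -> /fI.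
split; rewrite ?domS.
- by move=> _ [n _ <-]; case: (fP n).
- move=> _ _ [m _ <-] [n _ <-]; exists (f (pickle (m, n))).
    by exists (pickle (m, n)).
  by exists (m, n).
- move=> x y z [p _ [<- <- <-]].
  by split; [exists p.1 | exists p.2 | exists (pickle p)].
- move=> _ _ z [p _ [<- <-]] [q _ [<- /fI eqpq]].
  by rewrite (pcan_inj pickleK eqpq).
Qed.

Lemma sq_inj_extend {A S} : sq_inj A S -> infinite_set (sq_dom S) ->
  sq_dom S #<= A `\` sq_dom S -> exists2 S', S `<` S' & sq_inj A S'.
Proof.
move=> Sq; have leDD := sq_inj_card Sq; case: Sq.
set D := sq_dom S in leDD * => DA ex dom injS infD /card_subP[C eqCD CAD].
have [leCD leDC] : C #<= D /\ D #<= C.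
  by move: eqCD; rewrite card_eq_le => /andP[].
have infC : infinite_set C.
  by move=> /(card_le_finite leDC).
(* C is a copy of D outside D: map the pairs of M outside D * D into C. *)
pose M := D `|` C.
have leMM : M `*` M #<= C.
  have leMD : M #<= D.
    exact: card_le_trans (card_le_setU_setX infD (card_lexx _) leCD) leDD.
  exact: card_le_trans (card_le_trans (card_le_setX leMD leMD) leDD) leDC.
have [E totE injE] := card_leW_rel leMM.
pose N := [set t : T * T * T |
  [/\ M t.1.1, M t.1.2, ~ (D t.1.1 /\ D t.1.2), C t.2 & E t.1 t.2]].
have domS' : sq_dom (S `|` N) = M.
  apply/seteqP; split=> [x [z [/dom[Dx _ _]|[]//]]|x Mx]; first by left.
  have [[z Sz]|nDx] := pselect (D x); first by exists z; left.
  have [//|z Cz Ez] := totE (x, x); exists z; right; split=> //=.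
  by case.
exists (S `|` N).
  split=> [|sub]; first by move=> t St; left.
  (* The extension is strict: a point of [C] is in the new domain but not in [D]. *)
  have [c Cc] := infinite_setN0 infC.
  have [z /sub/dom[Dc _ _]] : sq_dom (S `|` N) c by rewrite domS'; right.
  by have [] := CAD _ Cc.
split; rewrite ?domS'.
- by move=> x [/DA|/CAD[]].
- move=> x y Mx My; have [[Dx Dy]|nD] := pselect (D x /\ D y).
    by have [z Dz Sz] := ex _ _ Dx Dy; exists z; left.
  have [//|z Cz Ez] := totE (x, y).
  by exists z; right.
- by move=> x y z [/dom[]|[/=]]; split=> //; [left|left|left|right].
(* Old values lie in [D] and new ones in [C], which is disjoint from [D], so the mixed cases cannot
   occur. *)
- have domz p z : S (p, z) -> D z.
    by case: p => x y Sz; have [] := dom _ _ _ Sz.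
  move=> p q z [Sp|[_ _ _ Cz Ep]] [Sq|[_ _ _ Cz' Eq]].
  + exact: injS Sp Sq.
  + by have [_ []] := CAD _ Cz'; exact: domz Sp.
  + by have [_ []] := CAD _ Cz; exact: domz Sq.
  + exact: injE Ep Eq.
Qed.

(** A maximal graph cannot be extended, so the complement of its domain [D] is no larger than [D];
    hence [A] embeds in [D * D], thus in [D]. *)
Lemma card_setX_infinite A : infinite_set A -> A `*` A #<= A.
Proof.
move=> /sq_inj_nat[S0 S0q infS0].
have [|S [Sq Smax]] :=
    @Zorn_bigcup _ [set S | S = set0 \/ S0 `<=` S /\ sq_inj A S].
  move=> F FQ totF /=.
  have [nF|/existsNP[S /not_implyP[FS neS]]] :=
      pselect (forall S, F S -> S = set0).
    by left; rewrite bigcup0.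
  have [/neS[]|[S0S _]] := FQ _ FS.
  right; split; first by move=> p /S0S Sp; exists S.
  apply: sq_inj_bigcup => // S' /FQ[->|[]//].
  by split=> [x [z []]|x y [z []]|x y z []|p q z []].
case: Sq => [S00|[S0S Sq]].
  exfalso; apply: (Smax S0); last by right; split.
  rewrite S00; split=> // sub.
  by have [x [z /sub]] := infinite_setN0 infS0.
have infS : infinite_set (sq_dom S).
  exact: sub_infinite_set (sub_sq_dom S0S) infS0.
have [leDC|leCD] := card_le_total (sq_dom S) (A `\` sq_dom S).
  have [S' SS' S'q] := sq_inj_extend Sq infS leDC.
  exfalso; apply: (Smax S' SS'); right; split=> //.
  by apply: subset_trans S0S _; case: SS'.
have leDD := sq_inj_card Sq.
have [DA _ _ _] := Sq.
have leAD : A #<= sq_dom S.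
  rewrite -(setDUK DA).
  by apply: card_le_trans leDD; exact: card_le_setU_setX.
apply: card_le_trans (card_le_setX leAD leAD) _.
exact: card_le_trans leDD (subset_card_le DA).
Qed.

End Squares.

(** * Few small sets do not cover [kappa] *)

(** A covering would embed [kappa] in [B * lambda], whose cardinality is at most the larger of those
    of [B] and [lambda], as [lambda] is infinite. *)
Lemma bigcup_neqT_card_lt {kappa lambda I : Type} {B : set I}
    {F : I -> set kappa} :
  infinite_set [set: lambda] -> [set: lambda] #< [set: kappa] ->
  (forall i, B i -> F i #<= [set: lambda]) -> ~ ([set: kappa] #<= B) ->
  exists x, forall i, B i -> ~ F i x.
Proof.
move=> lambda_inf lt_lambda_kappa leF nleB; apply: contrapT => nex.
have leXB : [set: kappa] #<= B `*` [set: lambda].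
  have ex i : exists E : kappa -> lambda -> Prop, B i ->
      (forall x, F i x -> exists y, E x y) /\
      (forall x x' y, E x y -> E x' y -> x = x').
    have [Bi|nBi] := pselect (B i); last by exists (fun _ _ => False).
    have [E totE injE] := card_leW_rel (leF _ Bi).
    by exists E => _; split=> // x /totE[y _ Exy]; exists y.
  have [E EP] := choice ex.
  apply: (@card_le_rel _ _ _ _ (fun x p => B p.1 /\ E p.1 x p.2)).
    move=> x _; have [i Bi Fix] : exists2 i, B i & F i x.
      apply: contrapT => ni; apply: nex; exists x => i Bi Fix.
      by apply: ni; exists i.
    have [totE _] := EP _ Bi; have [y Exy] := totE _ Fix.
    by exists (i, y).
  move=> x x' [i y] _ _ /= [Bi Exy] [_ Ex'y].
  by have [_ injE] := EP _ Bi; exact: injE Exy Ex'y.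
have [leBl|lelB] := card_le_total B [set: lambda].
  have leXl : [set: kappa] #<= [set: lambda].
    apply: card_le_trans leXB _.
    apply: card_le_trans (card_le_setX leBl (card_lexx _)) _.
    exact: card_setX_infinite.
  move: lt_lambda_kappa; rewrite /card_lt card_eq_le leXl.
  by case: (_ #<= _).
apply: nleB; apply: card_le_trans leXB _.
apply: card_le_trans (card_le_setX (card_lexx _) lelB) _.
apply: card_setX_infinite => finB; apply: lambda_inf.
exact: card_le_finite lelB finB.
Qed.

(** By regularity each [F i] has a strict upper bound [a i], and the bounds, being too few to be
    cofinal, have a strict upper bound [b], which lies in no [F i]. *)
Lemma bigcup_neqT_regular {kappa I : Type} {B : set I} {F : I -> set kappa} :
  regular_cardinal kappa ->
  (forall i, B i -> F i #< [set: kappa]) -> ~ ([set: kappa] #<= B) ->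
  exists x, forall i, B i -> ~ F i x.
Proof.
move=> [kappa_inf [R [Rwo _] Rreg]] ltF nleB.
(* Totality comes from the least element of the pair of [x] and [y]. *)
have Rtot x y : R x y \/ R y x.
  have [|z [[+ zmin] _]] := Rwo [pred t | asbool (t = x \/ t = y)].
    by exists x; apply/asboolP; left.
  have Rz t : t = x \/ t = y -> R z t by move=> txy; apply: zmin; apply/asboolP.
  by move=> /asboolP[zx|zy]; [left; rewrite -{1}zx|right; rewrite -{1}zy];
    apply: Rz; [right|left].
have unbounded (C : set kappa) : ~ (C #= [set: kappa]) ->
    exists a, forall c, C c -> ~ R a c.
  move=> neC; apply: contrapT => nex; apply: neC; apply: Rreg => a.
  apply: contrapT => na; apply: nex; exists a => c Cc Rac.
  by apply: na; exists c.
have ex i : exists a, B i -> forall c, F i c -> ~ R a c.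
  have [Bi|nBi] := pselect (B i).
    have [|a aP] := unbounded (F i); last by exists a.
    by have /andP[_ /negP] := ltF _ Bi.
  by have [a _] := infinite_setN0 kappa_inf; exists a.
have [a aP] := choice ex.
have [|b bP] := unbounded (a @` B).
  rewrite card_eq_le => /andP[_ leXa]; apply: nleB.
  exact: card_le_trans leXa (card_image_le _ _).
exists b => i Bi Fib.
have [Rba|Rab] := Rtot b (a i); first by apply: bP Rba; exists i.
exact: aP Bi _ Fib Rab.
Qed.

Theorem proposition2 (kappa lambda mu : Type)
    (kappa_inf : infinite_set [set: kappa])
    (lambda_inf : infinite_set [set: lambda])
    (mu_inf : infinite_set [set: mu])
    (le_lambda_kappa : [set: lambda] #<= [set: kappa])
    (le_mu_lambda : [set: mu] #<= [set: lambda])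
    (kappa_gt_or_regular :
      [set: lambda] #< [set: kappa] \/ regular_cardinal kappa)
    (X : topologicalType) :
  weakly_compact mu kappa X -> pseudo_compact kappa (COV kappa lambda mu) X.
Proof.
move=> Xc O Oopen On0; apply: contrapT => nex.
have [[ltCOV supCOV] _] := COV_min kappa le_mu_lambda.
have ltZ (Z : COV kappa lambda mu) : val Z #< [set: lambda].
  exact/ltCOV/set_mem/valP.
have small (x : X) : exists2 U, nbhs x U &
    ~ ([set: kappa] #<= [set Z | U `&` O Z !=set0]).
  apply: contrapT => nU; apply: nex; exists x => U xU.
  by apply: contrapT => nle; apply: nU; exists U.
pose V (alpha : kappa) :=
  interior (~` \bigcup_(Z in [set Z | val Z alpha]) O Z).
have VO alpha Z : val Z alpha -> V alpha `&` O Z `<=` set0.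
  by move=> Za x [/interior_subset nO OZx]; apply: nO; exists Z.
have [|||G [GV ltG denseG]] := Xc (range V).
- by move=> _ [alpha _ <-]; exact: open_interior.
- apply/seteqP; split=> // x _; have [U xU nleU] := small x.
  have [alpha alphaP] : exists alpha, forall Z : COV kappa lambda mu,
      U `&` O Z !=set0 -> ~ val Z alpha.
    case: kappa_gt_or_regular => [lt_lambda_kappa|kappa_reg].
      apply: (bigcup_neqT_card_lt lambda_inf lt_lambda_kappa _ nleU) => Z _.
      by have /andP[] := ltZ Z.
    apply: (bigcup_neqT_regular kappa_reg _ nleU) => Z _.
    exact: card_lt_le_trans (ltZ Z) le_lambda_kappa.
  exists (V alpha); first by exists alpha.
  apply: filterS xU => y Uy [Z Za OZy].
  by apply: (alphaP Z) Za; exists y.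
- exact: card_image_le.
(* Distinct indices may give the same [V alpha]; choosing one index for each member of [G] keeps
   fewer than [mu] of them. Outside [G] the value [k0] is arbitrary. *)
have ex A : exists alpha, G A -> V alpha = A.
  have [k0 _] := infinite_setN0 kappa_inf.
  have [GA|nGA] := pselect (G A); last by exists k0.
  by have [alpha _ <-] := GV _ GA; exists alpha.
have [f fP] := choice ex.
have ltW : f @` G #< [set: mu].
  have leW := card_image_le f G; have /andP[leG neG] := ltG.
  rewrite /card_lt (card_le_trans leW leG) /=.
  apply: contra neG; rewrite !card_eq_le leG => /andP[_ leW'] /=.
  exact: card_le_trans leW' leW.
have [Z COVZ WZ] := supCOV _ ltW.
pose z : COV kappa lambda mu := SigSub (mem_set COVZ).
(* Density gives a point of [O z] in some [V (f A)], although [f A] belongs to [Z]. *)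
have [x [Ox [A GA Ax]]] := denseG _ (On0 z) (Oopen z).
apply: (VO (f A) z _ x); first by apply: WZ; exists A.
by rewrite fP.
Qed.
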